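(* For every candidate state $s'$, $$|\mathrm{score}(s')|=\frac{1}{m(s')^2-1}.$$ Hence, among candidates, selecting the most negative score is exactly the same as minimizing the conformal module $m$.
   Context: $K$ is a cubic number field of signature $(1,1)$, with real embedding $\sigma_r$ and complex embedding $\sigma_c$; $L\subset\mathcal O_K$ is an order. A state is an ordered triple $s=(u_1,u_2,u_3)$ of elements of $L$ forming a $\mathbb Q$-basis of $K$ with $x_i=\sigma_r(u_i)>0$, sorted so that $x_1\ge x_2\ge x_3>0$. Put $\xi=(x_1,x_2,x_3)$, $\nu=(\sigma_c(u_1),\sigma_c(u_2),\sigma_c(u_3))=a+ib$ with $a,b\in\mathbb R^3$. Cross and dot products on $\mathbb C^3$ are bilinear. The score of $s$ is the negative real number $$\mathrm{score}(s)=-\frac{|\det(\xi,\nu,\bar\nu)|^2\,|\xi|^2}{|\langle n_1,n_1\rangle|^2},\qquad n_1=\xi\times\nu .$$ Conformal module: with $\hat\xi=\xi/|\xi|$, $a_\perp=a-\langle a,\hat\xi\rangle\hat\xi$, $b_\perp=b-\langle b,\hat\xi\rangle\hat\xi$, set $T=|a_\perp|^2+|b_\perp|^2$, $A_\perp=|a_\perp\times b_\perp|$ and $m(s)=T/(2A_\perp)\ge1$. Candidates: for $A,B,g\in\mathbb Z_{\ge0}$ the move $V(A,B,g)$ sends $(u_1,u_2,u_3)$ to $(u_1-g(u_2-Bu_3)-Au_3,\ u_2-Bu_3,\ u_3)$, and the move $W$ sends it to $(u_1-u_2,\ u_2,\ u_3-(u_1-u_2))$. A candidate $s'$ of a state $s$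 is the image of $s$ under such a move all of whose new real coordinates are positive; it is again a state after re-sorting (score and $m$ do not depend on the ordering). *)

(* Defs.v *)
From HB Require Import structures.
From mathcomp Require Import all_boot all_order all_algebra all_field.
From mathcomp Require Import complex reals.

Set Implicit Arguments.
Unset Strict Implicit.
Unset Printing Implicit Defensive.

Import Order.TTheory GRing.Theory Num.Theory.
Local Open Scope ring_scope.
Local Open Scope complex_scope.

Section NumberField.
Variables (R : realType) (K : fieldExtType rat).

Definition nonreal_embedding (s : {rmorphism K -> R[i]}) : Prop :=
  exists x, complex.Im (s x) != 0.

(* Signature (1, 1), with [sr] the real embedding and [sc] a chosen member of
   the pair of complex conjugate embeddings. *)
Definition signature11 (sr : {rmorphism K -> R}) (sc : {rmorphism K -> R[i]})
    : Prop :=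
  [/\ forall s : {rmorphism K -> R}, s =1 sr,
      nonreal_embedding sc
    & forall s : {rmorphism K -> R[i]}, nonreal_embedding s ->
        s =1 sc \/ s =1 (fun x => (sc x)^*)].

Definition ring_of_integers (x : K) : Prop := integralOver (intr : int -> K) x.

(* A subring of the ring of integers that is a lattice of full rank. *)
Definition is_order (L : {pred K}) : Prop :=
  [/\ subring_closed L,
      forall x, x \in L -> ring_of_integers x
    & exists2 e : (\dim {:K}).-tuple K,
        basis_of {:K} e & forall x, x \in L <-> inIntSpan e x].

End NumberField.

(* Bilinear dot and cross products (no conjugation over the complex numbers). *)
Section Products.
Variable F : pzRingType.

Definition dot (u v : 'rV[F]_3) : F := \sum_(i < 3) u 0 i * v 0 i.

Definition cross (u v : 'rV[F]_3) : 'rV[F]_3 :=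
  \row_(i < 3) [:: u 0 1 * v 0 2 - u 0 2 * v 0 1;
                   u 0 2 * v 0 0 - u 0 0 * v 0 2;
                   u 0 0 * v 0 1 - u 0 1 * v 0 0]`_i.

Definition det3 (C : comPzRingType) (u v w : 'rV[C]_3) : C :=
  \det (\matrix_(i < 3) [:: u; v; w]`_i).

End Products.

Definition enorm (R : rcfType) (v : 'rV[R]_3) : R := Num.sqrt (dot v v).

Definition cmod (R : rcfType) (z : R[i]) : R := ComplexField.Normc.normc z.

Section States.
Variables (R : realType) (K : fieldExtType rat).
Variables (sr : {rmorphism K -> R}) (sc : {rmorphism K -> R[i]}).
Implicit Type u : 'rV[K]_3.

Definition xi u : 'rV[R]_3 := map_mx sr u.
Definition nu u : 'rV[R[i]]_3 := map_mx sc u.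
Definition nubar u : 'rV[R[i]]_3 := map_mx (@conjc R) (nu u).
Definition xiC u : 'rV[R[i]]_3 := map_mx (real_complex R) (xi u).
Definition n1 u : 'rV[R[i]]_3 := cross (xiC u) (nu u).

Definition is_state (L : {pred K}) u : Prop :=
  [/\ forall i, u 0 i \in L,
      basis_of {:K} [seq u 0 i | i : 'I_3]
    & [/\ xi u 0 1 <= xi u 0 0, xi u 0 2 <= xi u 0 1 & 0 < xi u 0 2]].

Definition score u : R :=
  - (cmod (det3 (xiC u) (nu u) (nubar u)) ^+ 2 * enorm (xi u) ^+ 2
     / cmod (dot (n1 u) (n1 u)) ^+ 2).

Definition xihat u : 'rV[R]_3 := (enorm (xi u))^-1 *: xi u.
Definition perp u (v : 'rV[R]_3) : 'rV[R]_3 := v - dot v (xihat u) *: xihat u.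
Definition a_perp u : 'rV[R]_3 := perp u (map_mx (@complex.Re R) (nu u)).
Definition b_perp u : 'rV[R]_3 := perp u (map_mx (@complex.Im R) (nu u)).

Definition conformal_module u : R :=
  (enorm (a_perp u) ^+ 2 + enorm (b_perp u) ^+ 2)
  / (2 * enorm (cross (a_perp u) (b_perp u))).

Inductive move := V (A B g : nat) | W.

Definition apply_move (mv : move) u : 'rV[K]_3 :=
  let u1 := u 0 0 in let u2 := u 0 1 in let u3 := u 0 2 in
  match mv with
  | V A B g =>
      \row_(i < 3) [:: u1 - (u2 - u3 *+ B) *+ g - u3 *+ A; u2 - u3 *+ B; u3]`_i
  | W => \row_(i < 3) [:: u1 - u2; u2; u3 - (u1 - u2)]`_i
  end.

(* A candidate is kept in the order produced by the move; it becomes a state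
   once sorted, and [score] and [conformal_module] ignore the order. *)
Definition candidate u u' : Prop :=
  (exists mv, u' = apply_move mv u) /\ (forall i, 0 < xi u' 0 i).

End States.

(* Main.v *)
Require Import Defs.
From mathcomp Require Import all_boot all_order all_algebra all_field.
From mathcomp Require Import complex reals ring.


(** Write [x] for the real vector of a candidate [u], [nu = a + i b] for its
    complex vector and [n1] for their cross product. There are two independent
    ingredients.

    The identity. Lagrange's identity, over the complex numbers, gives
    [<n1, n1> = |x|^2 <nu, nu> - <x, nu>^2 = |x|^2 <nu', nu'>], where
    [nu' = a' + i b'] is the component of [nu] orthogonal to [x]. Since
    [<nu', nu'> = |a'|^2 - |b'|^2 + 2 i <a', b'>], Lagrange's identity over the
    reals gives [|<nu', nu'>|^2 = T^2 - 4 A^2] with [T = |a'|^2 + |b'|^2] and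
    [A = |a' x b'|]. On the other hand [det (x, nu, conj nu)] equals
    [- 2 i det (x, a, b)], whose modulus is [2 |x| A]. Hence the score is
    [- 4 A^2 / (T^2 - 4 A^2) = - 1 / (m^2 - 1)], provided that the two
    quantities [det (x, nu, conj nu)] and [<n1, n1>] do not vanish
    ([score_conformal]).

    The nonvanishing ([embeddings_nondegenerate]). The moves are unimodular, so
    the entries of [u] still form a basis of K. Choose t in K with a nonreal
    complex image and let N be the rational matrix of multiplication by t in
    the basis [u]. Applying the embeddings to [u N = t u] shows that [x], [nu]
    and [conj nu] are eigenvectors of N for the three distinct conjugates of t,
    hence they are linearly independent. The transpose of N has an eigenvector
    [w] over K for t as well, which is proportional to the dual basis of [u]
    for the trace form. Its image under the conjugate of the complex embedding
    is orthogonal to [x] and [nu], for the eigenvalues differ; it is thus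
    proportional to [n1]. So [<n1, n1> = 0] would force
    [w_1^2 + w_2^2 + w_3^2 = 0] in K, which the real embedding forbids.

    The strict inequality [m > 1] also follows, and then the score is an
    increasing function of m, so both have the same minimizers. *)

Set Implicit Arguments.
Unset Strict Implicit.
Unset Printing Implicit Defensive.

Import Order.TTheory GRing.Theory Num.Theory.
Local Open Scope ring_scope.
Local Open Scope complex_scope.

(** * Dot and cross products in dimension three *)

Lemma dotE (F : pzRingType) (u v : 'rV[F]_3) :
  dot u v = u 0 0 * v 0 0 + u 0 1 * v 0 1 + u 0 2 * v 0 2.
Proof.
rewrite /dot !big_ord_recl big_ord0 addr0 addrA.
by congr (_ + _ * _ + _ * _); congr (_ 0 _); apply: val_inj.
Qed.

Lemma ord3_ind (P : 'I_3 -> Prop) : P 0 -> P 1 -> P 2 -> forall i, P i.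
Proof.
move=> p0 p1 p2 -[[|[|[|//]]] hi]; [move: p0 | move: p1 | move: p2];
  by congr P; apply: val_inj.
Qed.

Lemma row3P (F : Type) (u v : 'rV[F]_3) :
  u 0 0 = v 0 0 -> u 0 1 = v 0 1 -> u 0 2 = v 0 2 -> u = v.
Proof. by move=> h0 h1 h2; apply/rowP; apply: ord3_ind. Qed.

Lemma dotC (F : comPzRingType) (u v : 'rV[F]_3) : dot u v = dot v u.
Proof. by apply: eq_bigr => i _; rewrite mulrC. Qed.

Lemma dot_map (F G : pzRingType) (f : {rmorphism F -> G}) (u v : 'rV[F]_3) :
  dot (map_mx f u) (map_mx f v) = f (dot u v).
Proof.
by rewrite /dot rmorph_sum; apply: eq_bigr => i _; rewrite !mxE rmorphM.
Qed.

Lemma dot_mulmx (F : comPzRingType) (u v : 'rV[F]_3) (N : 'M[F]_3) :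
  dot (u *m N^T) v = dot u (v *m N).
Proof.
have dotM (x y : 'rV[F]_3) : dot x y = (x *m y^T) 0 0.
  by rewrite mxE; apply: eq_bigr => i _; rewrite mxE.
by rewrite !dotM trmx_mul mulmxA.
Qed.

Lemma dotZl (F : comPzRingType) a (u v : 'rV[F]_3) :
  dot (a *: u) v = a * dot u v.
Proof. by rewrite !dotE !mxE; ring. Qed.

Lemma dotZr (F : comPzRingType) a (u v : 'rV[F]_3) :
  dot u (a *: v) = a * dot u v.
Proof. by rewrite !dotE !mxE; ring. Qed.

(** Lagrange's identity. *)
Lemma dot_cross (F : comPzRingType) (u v : 'rV[F]_3) :
  dot (cross u v) (cross u v) = dot u u * dot v v - dot u v ^+ 2.
Proof. by rewrite !dotE !mxE /=; ring. Qed.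

Lemma det3E (F : comPzRingType) (u v w : 'rV[F]_3) :
  det3 u v w = dot (cross u v) w.
Proof.
(* Reading coordinates through a function on [nat] lets the nested [lift]s of
   the Laplace expansion compute. *)
have rowE (x : 'rV[F]_3) : exists f : nat -> F, forall i, x 0 i = f i.
  by exists (fun k => x 0 (inord k)) => i; rewrite inord_val.
have [[f uE] [g vE] [h wE]] := And3 (rowE u) (rowE v) (rowE w).
rewrite /det3 (expand_det_row _ 0) !big_ord_recl big_ord0 /cofactor.
rewrite !(expand_det_row _ 0) !big_ord_recl !big_ord0 /cofactor !det_mx11.
by rewrite dotE !mxE /= !uE !vE !wE /= /bump /=; ring.
Qed.

(** The Gram determinant of three vectors is the square of their determinant;
    the right-hand side is its expansion along the first row. *)
Lemma gram3 (F : comPzRingType) (u v w : 'rV[F]_3) :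
  det3 u v w ^+ 2 =
    dot u u * (dot v v * dot w w - dot v w ^+ 2)
    - dot u v * (dot u v * dot w w - dot v w * dot u w)
    + dot u w * (dot u v * dot v w - dot v v * dot u w).
Proof. by rewrite det3E !dotE !mxE /=; ring. Qed.

Lemma dot_ge0 (R : realDomainType) (u : 'rV[R]_3) : 0 <= dot u u.
Proof. by apply: sumr_ge0 => i _; rewrite -expr2 sqr_ge0. Qed.

Lemma dot_gt0 (R : realDomainType) (u : 'rV[R]_3) : u != 0 -> 0 < dot u u.
Proof.
move=> u0; rewrite lt_neqAle dot_ge0 andbT eq_sym; apply: contra u0 => /eqP d0.
apply/eqP/rowP => i; rewrite mxE; apply/eqP; rewrite -sqrf_eq0 expr2; apply/eqP.
have sq_ge0 j : true -> 0 <= u 0 j * u 0 j by rewrite -expr2 sqr_ge0.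
exact: (psumr_eq0P sq_ge0 d0).
Qed.

Lemma enorm_sqr (R : rcfType) (u : 'rV[R]_3) : enorm u ^+ 2 = dot u u.
Proof. by rewrite /enorm sqr_sqrtr ?dot_ge0. Qed.

Lemma cmod_sqr (R : rcfType) (z : R[i]) :
  cmod z ^+ 2 = complex.Re z ^+ 2 + complex.Im z ^+ 2.
Proof. by case: z => x y; rewrite /cmod /= sqr_sqrtr // addr_ge0 ?sqr_ge0. Qed.

(** * Complex vectors in terms of real and imaginary parts *)

(** Writing [z = a + i b], replace [conj z] by [z + conj z = 2 a], then [z] by
    [z - a = i b], and swap the last two vectors. *)
Lemma det3_conj (R : rcfType) (x : 'rV[R]_3) (z : 'rV[R[i]]_3) :
  det3 (map_mx (real_complex R) x) z (map_mx (@conjc R) z) =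
    0 +i* (- 2 * det3 x (map_mx (@complex.Re R) z) (map_mx (@complex.Im R) z)).
Proof.
rewrite !det3E !dotE !mxE /=.
case: (z 0 0) => a0 b0; case: (z 0 1) => a1 b1; case: (z 0 2) => a2 b2.
by simpc => /=; congr (_ +i* _); ring.
Qed.

Lemma dot_complex (R : rcfType) (u v : 'rV[R[i]]_3) :
  let a := map_mx (@complex.Re R) u in let b := map_mx (@complex.Im R) u in
  let c := map_mx (@complex.Re R) v in let d := map_mx (@complex.Im R) v in
  dot u v = (dot a c - dot b d) +i* (dot a d + dot b c).
Proof.
rewrite /= !dotE !mxE /=.
case: (u 0 0) => a0 b0; case: (u 0 1) => a1 b1; case: (u 0 2) => a2 b2.
case: (v 0 0) => c0 d0; case: (v 0 1) => c1 d1; case: (v 0 2) => c2 d2.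
by simpc => /=; congr (_ +i* _); ring.
Qed.
(** * Nonvanishing of the determinant and of [<n1, n1>] *)

(** A vector [z] orthogonal to [x] and [y] is proportional to [cross x y], so
    over any field an isotropic [cross x y] would make [z] isotropic too. The
    proportionality is the triple product expansion of
    [cross (cross z (cross x y)) z]. *)
Lemma cross_anisotropic (F : fieldType) (x y z : 'rV[F]_3) :
  cross x y != 0 -> dot z x = 0 -> dot z y = 0 -> dot z z != 0 ->
  dot (cross x y) (cross x y) != 0.
Proof.
set c := cross x y => c0 zx zy zz.
have eqz : dot z z *: c = dot z c *: z.
  apply/eqP; rewrite -subr_eq0; apply/eqP.
  transitivity (cross (dot z y *: x - dot z x *: y) z); last first.
    rewrite zx zy; apply: row3P; rewrite !mxE /=; ring.
  by apply: row3P; rewrite !dotE !mxE /=; ring.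
apply: contra c0 => /eqP cc.
have zc : dot z c = 0.
  apply/eqP; rewrite -sqrf_eq0 expr2 -dotZl -eqz dotZl cc mulr0 //.
by move/eqP: eqz; rewrite zc scale0r scaler_eq0 (negPf zz).
Qed.

(** The polynomial [(N - a) (N - b)] kills [x] and [y] and multiplies [z] by
    [(c - a) (c - b)]. *)
Lemma eigen_coef0 (F : fieldType) (N : 'M[F]_3) (x y z : 'rV[F]_3)
    (a b c k l m : F) :
  x *m N = a *: x -> y *m N = b *: y -> z *m N = c *: z ->
  z != 0 -> a != c -> b != c -> k *: x + l *: y + m *: z = 0 -> m = 0.
Proof.
move=> xN yN zN z0 ac bc E.
have step k' l' m' : k' *: x + l' *: y + m' *: z = 0 ->
    (k' * a) *: x + (l' * b) *: y + (m' * c) *: z = 0.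
  move/(congr1 (mulmx^~ N)); rewrite mul0mx !mulmxDl -!scalemxAl xN yN zN.
  by rewrite !scalerA.
have E1 := step _ _ _ E; have E2 := step _ _ _ E1.
have : (m * (c - a) * (c - b)) *: z = 0.
  transitivity ((k * a * a) *: x + (l * b * b) *: y + (m * c * c) *: z
    - (a + b) *: ((k * a) *: x + (l * b) *: y + (m * c) *: z)
    + (a * b) *: (k *: x + l *: y + m *: z)).
    by apply/rowP => j; rewrite !mxE; ring.
  by rewrite E E1 E2 !scaler0 subr0 addr0.
move/eqP; rewrite scaler_eq0 (negPf z0) orbF !mulf_eq0 !subr_eq0.
by rewrite ![c == _]eq_sym (negPf ac) (negPf bc) !orbF => /eqP.
Qed.

Lemma det3_eigen (F : fieldType) (N : 'M[F]_3) (x y z : 'rV[F]_3) (a b c : F) :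
  x *m N = a *: x -> y *m N = b *: y -> z *m N = c *: z ->
  x != 0 -> y != 0 -> z != 0 -> a != b -> a != c -> b != c ->
  det3 x y z != 0.
Proof.
move=> xN yN zN x0 y0 z0 ab ac bc; apply/det0P => -[v v0].
have -> : v *m (\matrix_(i < 3) [:: x; y; z]`_i)
     = v 0 0 *: x + v 0 1 *: y + v 0 2 *: z.
  apply/rowP => j; rewrite [LHS]mxE.
  transitivity (dot v (\row_i ([:: x; y; z]`_i : 'rV[F]_3) 0 j)).
    by apply: eq_bigr => i _; rewrite !mxE.
  by rewrite dotE !mxE.
move=> E; case/eqP: v0; apply: row3P; rewrite mxE.
- apply: (@eigen_coef0 _ N y z x b c a (v 0 1) (v 0 2)) => //;
    rewrite 1?eq_sym //.
  by rewrite -E addrC addrA.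
- apply: (@eigen_coef0 _ N x z y a c b (v 0 0) (v 0 2)) => //;
    rewrite 1?eq_sym //.
  by rewrite -E addrAC.
- exact: (@eigen_coef0 _ N x y z a b c (v 0 0) (v 0 1)).
Qed.

Lemma mul_matrix (K : fieldExtType rat) (u : 'rV[K]_3) (t : K) :
  basis_of {:K} [seq u 0 i | i : 'I_3] ->
  exists N : 'M[rat]_3, u *m map_mx (in_alg K) N = t *: u.
Proof.
set X := [tuple of [seq u 0 i | i <- ord_tuple 3]].
have -> : [seq u 0 i | i : 'I_3] = X by rewrite /X /= /image_mem enumT.
move=> bu; have bX : basis_of {:K} X by [].
exists (\matrix_(i, j) coord X i (t * u 0 j)); apply/rowP => j.
rewrite !mxE [RHS](coord_basis bX (memvf _)); apply: eq_bigr => i _.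
rewrite !mxE mulr_algr; congr (_ *: _).
by rewrite /X /= (nth_map i) ?size_enum_ord // nth_ord_enum.
Qed.

(** All embeddings agree on the rational matrix N, so one relation over K turns
    into an eigenvector relation for each embedding. *)
Lemma map_eigen (K : fieldExtType rat) (F : fieldType) (f : {rmorphism K -> F})
    (u : 'rV[K]_3) (N : 'M[rat]_3) (t : K) :
  u *m map_mx (in_alg K) N = t *: u ->
  map_mx f u *m map_mx ratr N = f t *: map_mx f u.
Proof.
move=> /(congr1 (map_mx f)); rewrite map_mxM map_mxZ -map_mx_comp => <-.
congr (_ *m _); apply: eq_map_mx => q.
by rewrite /= -(fmorph_eq_rat (f \o in_alg K)).
Qed.

(** The matrix [N - t] and its transpose have the same determinant. *)
Lemma trmx_eigen (F : fieldType) n (u : 'rV[F]_n) (N : 'M[F]_n) (t : F) :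
  u != 0 -> u *m N = t *: u -> exists2 w : 'rV[F]_n, w != 0 & w *m N^T = t *: w.
Proof.
move=> u0 uN.
have : \det (N - t%:M) == 0.
  by apply/det0P; exists u; rewrite // mulmxBr uN mul_mx_scalar subrr.
rewrite -det_tr linearB /= tr_scalar_mx => /det0P[w w0].
by rewrite mulmxBr mul_mx_scalar => /eqP; rewrite subr_eq0 => /eqP; exists w.
Qed.

(** The moves are invertible over the integers, so the old entries are integral
    combinations of the new ones. *)
Lemma apply_move_mem (K : fieldExtType rat) (V : {vspace K}) (mv : move)
    (u : 'rV[K]_3) :
  (forall i, apply_move mv u 0 i \in V) -> forall i, u 0 i \in V.
Proof.
move=> vV; have := vV 2%R; have := vV 1%R; have := vV 0%R => {vV}.
case: mv => [A B g|]; rewrite !mxE /= => h0 h1 h2; apply: ord3_ind => //.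
- rewrite -[u 0 0](subrK ((u 0 1 - u 0 2 *+ B) *+ g)) rpredD ?rpredMn //.
  by rewrite -[X in X \in V](subrK (u 0 2 *+ A)) rpredD ?rpredMn.
- by rewrite -[X in X \in V](subrK (u 0 2 *+ B)) rpredD ?rpredMn.
- by rewrite -[X in X \in V](subrK (u 0 1)) rpredD.
- by rewrite -[X in X \in V](subrK (u 0 0 - u 0 1)) rpredD.
Qed.

Lemma apply_move_basis (K : fieldExtType rat) (mv : move) (u : 'rV[K]_3) :
  basis_of {:K} [seq u 0 i | i : 'I_3] ->
  basis_of {:K} [seq apply_move mv u 0 i | i : 'I_3].
Proof.
move=> bu.
have size3 (x : 'rV[K]_3) : size [seq x 0 i | i : 'I_3] = 3%N.
  by rewrite size_map size_enum_ord.
rewrite basisEdim -(span_basis bu) (eqP (basis_free bu)) !size3 leqnn andbT.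
apply/span_subvP => _ /imageP[i _ ->]; apply: (@apply_move_mem _ _ mv) => j.
by apply: memv_span; apply: image_f.
Qed.

(** Compute [dot z (x *m N)] in two ways. *)
Lemma eigen_orth (F : fieldType) (N : 'M[F]_3) (z x : 'rV[F]_3) (a b : F) :
  z *m N^T = a *: z -> x *m N = b *: x -> a != b -> dot z x = 0.
Proof.
move=> zN xN ab; have := dot_mulmx z x N; rewrite zN xN dotZl dotZr.
by move/eqP; rewrite -subr_eq0 -mulrBl mulf_eq0 subr_eq0 (negPf ab) => /eqP.
Qed.

(** Unlike the complex vector [n1], the eigenvector [w] of the transpose of N
    lives over K: this is what allows the positivity available at the real
    place to be transported to the complex one. *)
Lemma embeddings_nondegenerate (R : realType) (K : fieldExtType rat)
    (sr : {rmorphism K -> R}) (sc : {rmorphism K -> R[i]}) (u : 'rV[K]_3) :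
  nonreal_embedding sc -> basis_of {:K} [seq u 0 i | i : 'I_3] ->
  [/\ xi sr u != 0, det3 (xiC sr u) (nu sc u) (nubar sc u) != 0
    & dot (n1 sr sc u) (n1 sr sc u) != 0].
Proof.
move=> [t imt] bu.
pose f1 : {rmorphism K -> R[i]} := real_complex R \o sr.
pose f3 : {rmorphism K -> R[i]} := (@conjc R) \o sc.
have -> : xiC sr u = map_mx f1 u by rewrite map_mx_comp.
have -> : nubar sc u = map_mx f3 u by rewrite map_mx_comp.
have n1E : n1 sr sc u = cross (map_mx f1 u) (map_mx sc u).
  by rewrite map_mx_comp.
have [N uN] := mul_matrix t bu.
have u0 : u 0 0 != 0.
  by apply: free_not0 (basis_free bu) _; apply: image_f.
have fu0 (F : fieldType) (f : {rmorphism K -> F}) (v : 'rV[K]_3) :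
    v != 0 -> map_mx f v != 0.
  by rewrite map_mx_eq0.
have un0 : u != 0 by apply: contra u0 => /eqP ->; rewrite mxE.
have d12 : f1 t != sc t.
  by apply: contra imt => /eqP <-.
have d13 : f1 t != f3 t.
  apply: contra imt; rewrite /f1 /f3 /=; case: (sc t) => p q /= /eqP[_ /eqP].
  by rewrite eq_sym oppr_eq0.
have d23 : sc t != f3 t.
  apply: contra imt; rewrite /f3 /=; case: (sc t) => p q /= /eqP[] /eqP.
  by rewrite -addr_eq0 -mulr2n mulrn_eq0.
have det0 : det3 (map_mx f1 u) (map_mx sc u) (map_mx f3 u) != 0.
  exact: det3_eigen (map_eigen f1 uN) (map_eigen sc uN) (map_eigen f3 uN)
    (fu0 _ _ _ un0) (fu0 _ _ _ un0) (fu0 _ _ _ un0) d12 d13 d23.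
split=> //; first exact: fu0.
rewrite n1E.
have [w w0 wN] := trmx_eigen un0 uN.
rewrite map_trmx in wN.
have orth (f g : {rmorphism K -> R[i]}) : f t != g t ->
    dot (map_mx f w) (map_mx g u) = 0.
  apply: eigen_orth (map_eigen g uN); rewrite map_trmx; exact: map_eigen wN.
apply: (@cross_anisotropic _ _ _ (map_mx f3 w)).
- by apply: contra det0 => /eqP E; rewrite det3E E dotE !mxE !mul0r !addr0.
- by apply: orth; rewrite eq_sym.
- by apply: orth; rewrite eq_sym.
- rewrite dot_map fmorph_eq0 -(fmorph_eq0 sr) -dot_map gt_eqF //.
  by apply: dot_gt0; apply: fu0.
Qed.

(** * The score as a function of the conformal module *)

Lemma dot_perp (R : realType) (K : fieldExtType rat)
    (sr : {rmorphism K -> R}) (u : 'rV[K]_3) (v w : 'rV[R]_3) :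
  xi sr u != 0 ->
  dot (perp sr u v) (perp sr u w) =
    dot v w - dot (xi sr u) v * dot (xi sr u) w / dot (xi sr u) (xi sr u).
Proof.
move=> x0; rewrite /perp /xihat; set x := xi sr u; have X0 := dot_gt0 x0.
rewrite -/x in X0 *.
have k2 : (enorm x)^-1 ^+ 2 = (dot x x)^-1 by rewrite exprVn enorm_sqr.
set k := _^-1 in k2 *.
have kX : k ^+ 2 * dot x x = 1 by rewrite k2 mulVf ?gt_eqF.
rewrite -k2.
(* With [k] in place of the inverse norm, the two sides differ by a multiple of
   [k ^+ 2 * dot x x - 1]. *)
transitivity (dot v w - dot x v * dot x w * k ^+ 2
   + (k ^+ 2 * dot x x - 1) * (dot x v * dot x w * k ^+ 2)); last first.
  by rewrite kX subrr mul0r addr0.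
by rewrite !dotE !mxE; ring.
Qed.

Lemma score_conformal (R : realType) (K : fieldExtType rat)
    (sr : {rmorphism K -> R}) (sc : {rmorphism K -> R[i]}) (u : 'rV[K]_3) :
  xi sr u != 0 -> det3 (xiC sr u) (nu sc u) (nubar sc u) != 0 ->
  dot (n1 sr sc u) (n1 sr sc u) != 0 ->
  1 < conformal_module sr sc u /\
  score sr sc u = - (1 / (conformal_module sr sc u ^+ 2 - 1)).
Proof.
move=> x0 det0 n0.
have X0 := dot_gt0 x0.
have cmod_gt0 (z : R[i]) : z != 0 -> 0 < cmod z ^+ 2.
  case: z => p q z0; rewrite cmod_sqr /= lt_neqAle addr_ge0 ?sqr_ge0 // andbT.
  rewrite eq_sym paddr_eq0 ?sqr_ge0 // !sqrf_eq0; apply: contra z0.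
  by case/andP => /eqP -> /eqP ->.
have := cmod_gt0 _ det0; have := cmod_gt0 _ n0.
rewrite /score /conformal_module.
set x := xi sr u in x0 X0 *.
pose a := map_mx (@complex.Re R) (nu sc u).
pose b := map_mx (@complex.Im R) (nu sc u).
set A := enorm (cross _ _).
have A2 : A ^+ 2 = dot (a_perp sr sc u) (a_perp sr sc u) *
    dot (b_perp sr sc u) (b_perp sr sc u)
    - dot (a_perp sr sc u) (b_perp sr sc u) ^+ 2.
  by rewrite enorm_sqr dot_cross.
have A_ge0 : 0 <= A by apply: sqrtr_ge0.
rewrite !enorm_sqr.
(* By [gram3], since [A ^+ 2] is the Gram determinant of the two components
   orthogonal to [x]. *)
have detE : cmod (det3 (xiC sr u) (nu sc u) (nubar sc u)) ^+ 2
    = 4 * dot x x * A ^+ 2.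
  rewrite det3_conj cmod_sqr /= -/x -/a -/b A2 !dot_perp // -/x -/a -/b.
  rewrite expr0n add0r exprMn gram3; field; exact: lt0r_neq0.
set P := dot (a_perp sr sc u) _; set Q := dot (b_perp sr sc u) _.
(* The dot square of [n1] is [dot x x * ((P - Q) + 2 i S)], where [S] is the dot
   product of [a_perp] and [b_perp], and [A ^+ 2 = P * Q - S ^+ 2]. *)
have normE : cmod (dot (n1 sr sc u) (n1 sr sc u)) ^+ 2
    = dot x x ^+ 2 * ((P + Q) ^+ 2 - 4 * A ^+ 2).
  have rex : map_mx (@complex.Re R) (xiC sr u) = x.
    by apply/rowP => i; rewrite !mxE.
  have imx : map_mx (@complex.Im R) (xiC sr u) = 0.
    by apply/rowP => i; rewrite !mxE.
  have dot0 (v : 'rV[R]_3) : dot 0 v = 0 by rewrite dotE !mxE !mul0r !addr0.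
  rewrite dot_cross !dot_complex rex imx -/a -/b !dot0 cmod_sqr A2.
  rewrite /P /Q !dot_perp // -/x -/a -/b (dotC b a) (dotC x 0) dot0 expr2.
  simpc => /=.
  by field; exact: lt0r_neq0.
rewrite detE normE => N0 D0.
have A0 : 0 < A.
  rewrite lt_neqAle A_ge0 andbT eq_sym; apply: contraTneq D0 => ->.
  by rewrite expr0n mulr0 ltxx.
have T0 : 0 < (P + Q) ^+ 2 - 4 * A ^+ 2.
  by move: N0; rewrite pmulr_rgt0 // exprn_gt0.
have PQ0 : 0 <= P + Q by rewrite addr_ge0 ?dot_ge0.
split.
  rewrite ltr_pdivlMr ?mulr_gt0 // mul1r -(@ltr_pXn2r _ 2) ?nnegrE ?mulr_ge0 //.
  by rewrite -subr_gt0 exprMn -natrX.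
by field; rewrite mulN1r !lt0r_neq0.
Qed.

Theorem proposition2p3 (R : realType) (K : fieldExtType rat)
    (hK : \dim {:K} = 3%N)
    (sr : {rmorphism K -> R}) (sc : {rmorphism K -> R[i]})
    (hsig : signature11 sr sc)
    (L : {pred K}) (hL : is_order L)
    (s : 'rV[K]_3) (hs : is_state sr L s) :
  (forall s', candidate sr s s' ->
     1 < conformal_module sr sc s' /\
     `|score sr sc s'| = 1 / (conformal_module sr sc s' ^+ 2 - 1)) /\
  (forall s', candidate sr s s' ->
     ((forall t, candidate sr s t -> score sr sc s' <= score sr sc t) <->
      (forall t, candidate sr s t ->
         conformal_module sr sc s' <= conformal_module sr sc t))).
Proof.
have key t : candidate sr s t -> 1 < conformal_module sr sc t /\
    score sr sc t = - (1 / (conformal_module sr sc t ^+ 2 - 1)).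
  case: hs => _ bs _ [[mv ->] _]; have [_ sc_nonreal _] := hsig.
  have bt := apply_move_basis mv bs.
  have [? ? ?] := embeddings_nondegenerate sr sc_nonreal bt.
  exact: score_conformal.
have sq_gt0 t : candidate sr s t -> 0 < conformal_module sr sc t ^+ 2 - 1.
  by move=> /key[m1 _]; rewrite subr_gt0 exprn_egt1.
have score_le t t' : candidate sr s t -> candidate sr s t' ->
    (score sr sc t <= score sr sc t') =
    (conformal_module sr sc t <= conformal_module sr sc t').
  move=> ct ct'; have [m1 ->] := key _ ct; have [m1' ->] := key _ ct'.
  rewrite lerN2 !div1r lef_pV2 ?posrE ?sq_gt0 // lerD2r ler_pXn2r // nnegrE;
    by apply: le_trans ler01 (ltW _).
split=> s' cs'.
  have [m1 ->] := key _ cs'; split=> //.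
  by rewrite normrN ger0_norm // divr_ge0 // ltW // sq_gt0.
by split=> h t ct; move: (h t ct); rewrite score_le.
Qed.
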